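(* For an integer $n\ge 2$, let $\lambda = 1 - n^{-2/3}$ and $a^2 = n^{-1/3}(1 - n^{-1/3})$. Let $C \in \mathbb{R}^{n\times n}$ be the lower-triangular Toeplitz matrix with $C_{i,j} = c_{i-j}$ for $i\ge j$ and $0$ otherwise, where $c_0 = 1$ and $c_k = a^2\lambda^{k-1}$ for $k\ge1$ (i.e. $C$ is generated by $1 + \frac{a^2 x}{1-\lambda x}$). Let $B = A^{(n)}C^{-1}$. Then $\|C\|_{1\to2}^2 \le O(1)$ and $\|B\|_{2\to\infty} \le O(n^{1/6})$.
   Context: $A^{(n)}$ is the $n\times n$ lower-triangular all-ones matrix. $\|B\|_{2\to\infty}$ is the maximum $\ell_2$ norm of a row and $\|C\|_{1\to2}$ the maximum $\ell_2$ norm of a column. $O(\cdot)$ hides absolute constants independent of $n$. *)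

(* Defs.v *)
From HB Require Import structures.
From mathcomp Require Import all_boot all_order all_algebra.
From mathcomp Require Import reals exp.
Set Implicit Arguments.
Unset Strict Implicit.
Unset Printing Implicit Defensive.
Import Order.TTheory GRing.Theory Num.Theory.
Local Open Scope ring_scope.

Definition lower_ones (R : realType) (n : nat) : 'M[R]_n :=
  \matrix_(i, j) (if (j <= i)%N then 1 else 0).

Definition lower_toeplitz (R : realType) (n : nat) (c : nat -> R) : 'M[R]_n :=
  \matrix_(i, j) (if (j <= i)%N then c (i - j)%N else 0).

(* Coefficients of the power series 1 + s x / (1 - lam x). *)
Definition c_coef (R : realType) (lam s : R) (k : nat) : R :=
  if k is k'.+1 then s * lam ^+ k' else 1.

(* In the two norms below the default value 0 of the iterated maximum is
   harmless, as the l2 norms are nonnegative. *)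
Definition norm_2_infty (R : realType) (m n : nat) (B : 'M[R]_(m, n)) : R :=
  \big[Num.max/0]_(i < m) Num.sqrt (\sum_(j < n) B i j ^+ 2).

Definition norm_1_2 (R : realType) (m n : nat) (C : 'M[R]_(m, n)) : R :=
  \big[Num.max/0]_(j < n) Num.sqrt (\sum_(i < m) C i j ^+ 2).

(* Main.v *)
(** Write [t = n^(-1/3)], so that [lam = 1 - t^2] and [a^2 = t - t^2]. Then
    [C] has generating function [(1 - (1 - t) x) / (1 - lam x)], and
    [B] has [(1 - lam x) / ((1 - x) (1 - (1 - t) x))
             = t / (1 - x) + (1 - t) / (1 - (1 - t) x)],
    i.e. [B] is Toeplitz with coefficients [t + (1 - t)^(k+1)]. Both norms are
    then bounded by geometric sums. *)

Require Import Defs.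
From HB Require Import structures.
From mathcomp Require Import all_boot all_order all_algebra.
From mathcomp Require Import reals exp.
From mathcomp Require Import ring lra.
Set Implicit Arguments.
Unset Strict Implicit.
Unset Printing Implicit Defensive.
Import Order.TTheory GRing.Theory Num.Theory.
Local Open Scope ring_scope.

Section LowerToeplitz.
Variables (R : realType) (n : nat).
Implicit Types (b c : nat -> R) (M : R).

(** Only indices k with j <= k <= i contribute to entry (i, j); the shift l = k - j turns what
    remains into a convolution, i.e. a product of generating functions. *)
Lemma mul_lower_toeplitz b c :
  lower_toeplitz n b *m lower_toeplitz n c =
  lower_toeplitz n (fun m => \sum_(l < m.+1) b (m - l)%N * c l).
Proof.
apply/matrixP => i j; rewrite !mxE.
under eq_bigr do rewrite !mxE.
have [le_ji|lt_ij] := leqP j i; last first.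
  apply: big1 => k _; case: leqP => [le_ki|_]; last by rewrite mul0r.
  by rewrite leqNgt (leq_ltn_trans le_ki lt_ij) mulr0.
pose F k := (if (k <= i)%N then b (i - k)%N else 0) *
            (if (j <= k)%N then c (k - j)%N else 0).
rewrite -(big_mkord xpredT F) (big_cat_nat (n := j)) ?(ltnW (ltn_ord j)) //=.
rewrite [X in X + _]big_nat_cond big1 ?add0r; last first.
  by move=> k /andP[/andP[_ lt_kj] _]; rewrite /F [(j <= k)%N]leqNgt lt_kj mulr0.
rewrite (big_cat_nat (n := i.+1)) ?leqW ?ltn_ord //=.
rewrite [X in _ + X]big_nat_cond [X in _ + X]big1 ?addr0; last first.
  by move=> k /andP[/andP[lt_ik _] _]; rewrite /F leqNgt lt_ik mul0r.
rewrite -{1}[nat_of_ord j]add0n big_addn subSn // big_mkord.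
apply: eq_bigr => l _; rewrite /F leq_addl addnK [(l + j)%N]addnC subnDA.
by rewrite -leq_subRL // -ltnS ltn_ord.
Qed.

Lemma lower_toeplitz_unit c : c 0%N = 1 -> lower_toeplitz n c \in unitmx.
Proof.
move=> c0; rewrite unitmxE det_trig.
  by rewrite big1 ?unitr1 // => i _; rewrite mxE leqnn subnn.
by apply/is_trig_mxP => i j lt_ij; rewrite mxE leqNgt lt_ij.
Qed.

Lemma sum_row_lower_toeplitz c (i : 'I_n) :
  \sum_(j < n) lower_toeplitz n c i j ^+ 2 = \sum_(k < i.+1) c k ^+ 2.
Proof.
pose F k := (if (k <= i)%N then c (i - k)%N else 0) ^+ 2.
rewrite (eq_bigr (fun j : 'I_n => F j)); last by move=> j _; rewrite mxE.
rewrite -(big_mkord xpredT F) (big_cat_nat (n := i.+1)) ?ltn_ord //=.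
rewrite [X in _ + X]big_nat_cond [X in _ + X]big1 ?addr0; last first.
  by move=> k /andP[/andP[lt_ik _] _]; rewrite /F leqNgt lt_ik expr0n.
(* Row i reads c_i, ..., c_0 from left to right, hence the reversal. *)
rewrite big_mkord (reindex_inj rev_ord_inj) /=.
by apply: eq_bigr => k _; rewrite /F subSS leq_subr subKn // -ltnS.
Qed.

Lemma sum_col_lower_toeplitz c (j : 'I_n) :
  \sum_(i < n) lower_toeplitz n c i j ^+ 2 = \sum_(k < n - j) c k ^+ 2.
Proof.
pose F k := (if (j <= k)%N then c (k - j)%N else 0) ^+ 2.
rewrite (eq_bigr (fun i : 'I_n => F i)); last by move=> i _; rewrite mxE.
rewrite -(big_mkord xpredT F) (big_cat_nat (n := j)) ?(ltnW (ltn_ord j)) //=.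
rewrite [X in X + _]big_nat_cond big1 ?add0r; last first.
  by move=> k /andP[/andP[_ lt_kj] _]; rewrite /F leqNgt lt_kj expr0n.
rewrite -{1}[nat_of_ord j]add0n big_addn big_mkord.
by apply: eq_bigr => k _; rewrite /F leq_addl addnK.
Qed.

(** Each row, and likewise each column, carries an initial segment of [c] of length at most n, so
    partial sums of squares control both norms. *)
Lemma norm_2_infty_toeplitz_le c M : 0 <= M ->
  (forall m, (m <= n)%N -> \sum_(k < m) c k ^+ 2 <= M ^+ 2) ->
  norm_2_infty (lower_toeplitz n c) <= M.
Proof.
move=> M0 cM; apply: bigmax_le => // i _.
by rewrite sum_row_lower_toeplitz -[leRHS](ger0_norm M0) -sqrtr_sqr ler_wsqrtr ?cM.
Qed.

Lemma norm_1_2_toeplitz_le c M : 0 <= M ->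
  (forall m, (m <= n)%N -> \sum_(k < m) c k ^+ 2 <= M ^+ 2) ->
  norm_1_2 (lower_toeplitz n c) <= M.
Proof.
move=> M0 cM; apply: bigmax_le => // j _.
rewrite sum_col_lower_toeplitz -[leRHS](ger0_norm M0) -sqrtr_sqr.
by rewrite ler_wsqrtr ?cM ?leq_subr.
Qed.

End LowerToeplitz.

Section Bounds.
Variables (R : realType) (t : R).

Definition b_coef (k : nat) : R := t + (1 - t) ^+ k.+1.

Lemma conv_b_c_coef m :
  \sum_(l < m.+1) b_coef (m - l)%N * c_coef (1 - t ^+ 2) (t * (1 - t)) l = 1.
Proof.
(* [P m] is the coefficient of x^(m-1) in b(x) / (1 - lam x). The sum is empty at m = 0, so the
   truncated predecessor does no harm. *)
pose P m := \sum_(l < m) b_coef (m.-1 - l)%N * (1 - t ^+ 2) ^+ l.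
have -> : \sum_(l < m.+1) b_coef (m - l)%N * c_coef (1 - t ^+ 2) (t * (1 - t)) l
    = b_coef m + t * (1 - t) * P m.
  rewrite big_ord_recl subn0 mulr1 mulr_sumr; congr (_ + _).
  apply: eq_bigr => l _; rewrite /= /bump add1n mulrCA.
  by case: m l => [[]|m l] //=; rewrite subSS.
elim: m => [|m IHm]; first by rewrite /P big_ord0 mulr0 addr0 /b_coef expr1 addrC subrK.
have PS : P m.+1 = b_coef m + (1 - t ^+ 2) * P m.
  rewrite /P big_ord_recl subn0 mulr1 mulr_sumr; congr (_ + _).
  apply: eq_bigr => l _; rewrite /= /bump add1n exprS mulrCA.
  by case: m l {IHm} => [[]|m l] //=; rewrite subSS.
rewrite PS.
(* The induction hypothesis eliminates [P m]; what is left amounts to b_(m+1) = (1 - t) b_m +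
   t^2. *)
transitivity (b_coef m.+1 + t * (1 - t) * b_coef m
              + (1 - t ^+ 2) * (t * (1 - t) * P m)); first by ring.
have -> : t * (1 - t) * P m = 1 - b_coef m by lra.
by rewrite /b_coef [_ ^+ m.+2]exprS; ring.
Qed.

(** The Toeplitz matrix of [c_coef] is unitriangular, hence invertible, so it suffices to multiply
    the candidate by it and recover the all-ones matrix. *)
Lemma lower_ones_mul_invmx n :
  lower_ones R n *m invmx (lower_toeplitz n (c_coef (1 - t ^+ 2) (t * (1 - t))))
  = lower_toeplitz n b_coef.
Proof.
set C := lower_toeplitz n _.
have <- : lower_toeplitz n b_coef *m C = lower_ones R n.
  rewrite mul_lower_toeplitz; apply/matrixP => i j; rewrite !mxE.
  by case: leqP => // _; rewrite conv_b_c_coef.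
by rewrite mulmxK // lower_toeplitz_unit.
Qed.

(** The left side telescopes to 1 - x^m. The undivided form also covers x = 1. *)
Lemma geometric_sum_le (x : R) m : 0 <= x -> (1 - x) * \sum_(k < m) x ^+ k <= 1.
Proof.
move=> x0.
have -> : (1 - x) * \sum_(k < m) x ^+ k = - ((x - 1) * \sum_(k < m) x ^+ k) by ring.
by rewrite -subrX1 opprB lerBlDr lerDl exprn_ge0.
Qed.

Hypotheses (t_gt0 : 0 < t) (t_le1 : t <= 1).

Lemma sum_c_coef_sqr_le m :
  \sum_(k < m) c_coef (1 - t ^+ 2) (t * (1 - t)) k ^+ 2 <= 2.
Proof.
case: m => [|m]; first by rewrite big_ord0.
rewrite big_ord_recl /= expr1n.
under eq_bigr do rewrite /= exprMn -exprM mulnC exprM.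
rewrite -mulr_sumr.
have := @geometric_sum_le ((1 - t ^+ 2) ^+ 2) m (sqr_ge0 _).
set S := \sum_(_ < _) _ => HS.
have S0 : 0 <= S by apply: sumr_ge0 => k _; rewrite exprn_ge0 // sqr_ge0.
(* As (1 - lam^2) S <= 1, this bounds the tail by 1, on top of the leading 1. *)
suff le_coef : (t * (1 - t)) ^+ 2 <= 1 - (1 - t ^+ 2) ^+ 2.
  by have := ler_wpM2r S0 le_coef; lra.
have -> : 1 - (1 - t ^+ 2) ^+ 2 = t ^+ 2 * (2 - t ^+ 2) by ring.
rewrite exprMn ler_wpM2l ?sqr_ge0 //.
have : t * t <= t by rewrite ler_piMr // ltW.
by have := t_gt0; rewrite !expr2; lra.
Qed.

(** By (x + y)^2 <= 2 x^2 + 2 y^2, the constant part t contributes m t^2 and the geometric part at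
    most 1/t. *)
Lemma sum_b_coef_sqr_le m :
  \sum_(k < m) b_coef k ^+ 2 <= 2 * (m%:R * t ^+ 2 + t^-1).
Proof.
have HS := @geometric_sum_le ((1 - t) ^+ 2) m (sqr_ge0 _).
set S := \sum_(_ < _) _ in HS.
have S0 : 0 <= S by apply: sumr_ge0 => k _; rewrite exprn_ge0 // sqr_ge0.
have leS : S <= t^-1.
  (* Since 1 - (1 - t)^2 = t + t (1 - t), dropping the second term leaves t S <= 1. *)
  have : 0 <= t * (1 - t) * S by rewrite !mulr_ge0 ?subr_ge0 // ltW.
  by rewrite -[_^-1]mul1r ler_pdivlMr //; move: HS; lra.
apply: (@le_trans _ _ (2 * (m%:R * t ^+ 2 + S))); last by lra.
have -> : m%:R * t ^+ 2 = \sum_(k < m) t ^+ 2.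
  by rewrite sumr_const card_ord mulr_natl.
rewrite /S -big_split mulr_sumr.
apply: ler_sum => k _ /=; rewrite /b_coef.
have -> : ((1 - t) ^+ 2) ^+ k = ((1 - t) ^+ k) ^+ 2 by rewrite -!exprM mulnC.
have u0 : 0 <= (1 - t) ^+ k by rewrite exprn_ge0 // subr_ge0.
rewrite [_ ^+ k.+1]exprS; set u := (1 - t) ^+ k in u0 *.
have v0 : 0 <= (1 - t) * u by rewrite mulr_ge0 // subr_ge0.
have le_vu : (1 - t) * u <= u by rewrite ler_piMl // gerBl ltW.
move: ((1 - t) * u) v0 le_vu => v v0 le_vu.
have : v * v <= u * u by rewrite ler_pM.
by have := sqr_ge0 (t - v); rewrite !expr2; lra.
Qed.

End Bounds.

Theorem theorem32 (R : realType) :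
  exists K1 K2 : R, forall (n : nat) (lam a : R),
    (2 <= n)%N ->
    lam = 1 - n%:R `^ (- (2 / 3)) ->
    a ^+ 2 = n%:R `^ (- (1 / 3)) * (1 - n%:R `^ (- (1 / 3))) ->
    let C : 'M[R]_n := lower_toeplitz n (c_coef lam (a ^+ 2)) in
    let B : 'M[R]_n := lower_ones R n *m invmx C in
    norm_1_2 C ^+ 2 <= K1 /\ norm_2_infty B <= K2 * n%:R `^ (1 / 6).
Proof.
(* The first 2 bounds the column sums of squares. The second comes from 2 (r^2 + r^2) = (2 r)^2 with
   r = n^(1/6). *)
exists 2, 2 => n lam a n2 -> ->.
have n0 : (0 : R) < n%:R by rewrite ltr0n (leq_trans _ n2).
set t := n%:R `^ (- (1 / 3)); set r := n%:R `^ (1 / 6).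
have r0 : 0 < r by rewrite powR_gt0.
have t0 : 0 < t by rewrite powR_gt0.
have -> : n%:R `^ (- (2 / 3)) = t ^+ 2.
  by rewrite -powR_mulrn ?(ltW t0) // /t -powRrM; congr (_ `^ _); lra.
(* The exponent -1/3 balances the two terms of the row bound: 1/t and n t^2 both equal n^(1/3) =
   r^2. *)
have tV : t^-1 = r ^+ 2.
  rewrite /t -powRN -powR_mulrn ?(ltW r0) // /r -powRrM.
  by congr (_ `^ _); lra.
have nt2 : n%:R * t ^+ 2 = r ^+ 2.
  rewrite -[n%:R in LHS]powRr1 ?(ltW n0) // -!powR_mulrn ?(ltW r0) ?(ltW t0) //.
  rewrite /t /r -!powRrM -powRD; first by congr (_ `^ _); lra.
  by rewrite (gt_eqF n0) implybT.
have t1 : t <= 1.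
  rewrite -[leRHS](powRr0 n%:R) ler_powR ?ler1n ?(leq_trans _ n2) //; lra.
move=> C B; split.
  have C2 : norm_1_2 C <= Num.sqrt 2.
    apply: norm_1_2_toeplitz_le => [|m _]; first exact: sqrtr_ge0.
    by rewrite sqr_sqrtr ?ler0n // sum_c_coef_sqr_le.
  (* Squaring the inequality needs nonnegativity, which the default value 0 of the maximum
     provides. *)
  have C0 : 0 <= norm_1_2 C by apply: bigmax_ge_id.
  have : norm_1_2 C ^+ 2 <= Num.sqrt 2 ^+ 2.
    by rewrite ler_sqr // nnegrE ?sqrtr_ge0.
  by rewrite sqr_sqrtr ?ler0n.
rewrite /B /C lower_ones_mul_invmx.
apply: norm_2_infty_toeplitz_le => [|m le_mn]; first by rewrite mulr_ge0 ?ltW.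
apply: le_trans (sum_b_coef_sqr_le t0 t1 m) _.
have : m%:R * t ^+ 2 <= n%:R * t ^+ 2 by rewrite ler_wpM2r ?sqr_ge0 ?ler_nat.
rewrite nt2 tV; lra.
Qed.
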